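(* Let $n\ge 1$ and let $\alpha$ be a real number with $0\le\alpha\le 1/n$. If $f\in\mathcal{Q}^\alpha((0,\infty)^n)$, then $f$ is an operator monotone function on $(0,\infty)^n$.
   Context: Write $\mathbb{R}_+^n=[0,\infty)^n$. Class $\mathcal{Q}^\alpha(U)$: let $U\subseteq\mathbb{R}^n$ be open and $\alpha\in\mathbb{R}$. A continuous positive function $f$ on $U$ belongs to $\mathcal{Q}^\alpha(U)$ if there exist a real number $\gamma$ and a positive (Borel) measure $\tau$ on $\mathbb{R}_+^n$ such that for all $z\in U$ $$\frac{1}{f(z)}=\gamma+\int_{\mathbb{R}_+^n}\frac{d\tau(\xi)}{\big((\xi_1+z_1)\cdots(\xi_n+z_n)\big)^\alpha}.$$ Functional calculus: for an $n$-tuple $A=(A_1,\dots,A_n)$ of pairwise commuting bounded self-adjoint operators on a complex Hilbert space, $E$ denotes the product of the spectral measures of $A_1,\dots,A_n$ (the joint spectral measure on $\mathbb{R}^n$), and $\sigma(A)$ denotes the joint spectrum of $A$ (equivalently, the support of $E$). For $f$ continuous on a neighborhood of $\sigma(A)$, $f(A)=\int_{\sigma(A)}f(s)\,dE(s)$. Operator monotonicity: let $U\subseteq\mathbb{R}^n$ be open. A real-valued continuous function $f$ on $U$ is called (globally) operator monotone on $U$ if for any $n$-tuples $A=(A_1,\dots,A_n)$ and $B=(B_1,\dots,B_n)$ of bounded self-adjoint operators on a Hilbert space, where the operators within $A$ commute pairwise and the operators within $B$ commute pairwise (no commutation between the $A_j$ and the $B_k$ is required), with $\sigma(A)\cup\sigma(B)\subset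 U$, the inequalities $A_j\le B_j$ $(j=1,\dots,n)$ imply $f(A)\le f(B)$. Here $S\le T$ means that $T-S$ is positive semidefinite. *)

(* Defs.v *)
From HB Require Import structures.
From mathcomp Require Import all_boot all_order all_algebra.
From mathcomp Require Import complex ring.
From mathcomp Require Import all_classical all_reals all_analysis.

Set Implicit Arguments.
Unset Strict Implicit.
Unset Printing Implicit Defensive.

Import Order.TTheory GRing.Theory Num.Theory.
Import numFieldNormedType.Exports.

Local Open Scope classical_set_scope.
Local Open Scope complex_scope.
Local Open Scope ring_scope.

Definition borel_rV (R : realType) (n : nat) : measurableType _ :=
  g_sigma_algebraType (@open 'rV[R]_n).

Definition positive_orthant (R : realType) (n : nat) : set 'rV[R]_n :=
  [set z | forall i, 0 < z ord0 i].

Definition nonneg_orthant (R : realType) (n : nat) : set 'rV[R]_n :=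
  [set z | forall i, 0 <= z ord0 i].

Arguments positive_orthant : clear implicits.
Arguments nonneg_orthant : clear implicits.

(* [tau] is a Borel measure on the whole space, integrated over the closed
   orthant only; this is the same datum as a Borel measure on the orthant. *)
Definition class_Q (R : realType) (n : nat) (alpha : R) (U : set 'rV[R]_n)
    (f : 'rV[R]_n -> R) : Prop :=
  [/\ {within U, continuous f},
      forall z, U z -> 0 < f z &
      exists (gamma : R) (tau : {measure set (borel_rV R n) -> \bar R}),
        forall z, U z ->
          ((f z)^-1)%:E =
          (gamma%:E +
           \int[tau]_(xi in nonneg_orthant R n)
             (((\prod_(i < n) (xi ord0 i + z ord0 i)) `^ alpha)^-1)%:E)%E].

Record hilbertSpace (R : realType) := HilbertSpace {
  hilbert_carrier :> completeNormedModType R[i];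
  hdot : {dot hilbert_carrier for Num.conj};
  hdot_norm : forall x, `|x| ^+ 2 = hdot x x
}.

Section operators.
Context (R : realType) (H : hilbertSpace R).

Definition bounded_op (T : H -> H) : Prop :=
  exists M : R[i], forall x, `|T x| <= M * `|x|.

Definition self_adjoint (T : H -> H) : Prop :=
  forall x y, hdot H (T x) y = hdot H x (T y).

Definition op_le (S T : H -> H) : Prop :=
  forall x, 0 <= hdot H (T x - S x) x.

Definition orthogonal_projection (P : H -> H) : Prop :=
  self_adjoint P /\ forall x, P (P x) = P x.

End operators.

(* Projection-valued measures. As for scalar measures in the library, the
   values on non-measurable sets are irrelevant; requiring projections there too
   (0, say) is what makes [scalar_measure] below a {measure set T -> \bar R}. *)
Record spectral_measure (R : realType) (H : hilbertSpace R)
    (d : measure_display) (T : measurableType d) := SpectralMeasure {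
  spm :> set T -> {linear H -> H};
  spm_proj : forall D, orthogonal_projection (spm D);
  spm0 : forall x, spm set0 x = 0;
  spmT : forall x, spm setT x = x;
  spmI : forall C D, measurable C -> measurable D ->
    forall x, spm (C `&` D) x = spm C (spm D x);
  spm_sigma_additive : forall F : nat -> set T,
    (forall i, measurable (F i)) -> trivIset setT F ->
    forall x, series (fun i => spm (F i) x) @ \oo --> spm (\bigcup_i F i) x
}.

Section scalar_measure.
Context (R : realType) (H : hilbertSpace R) (d : measure_display)
  (T : measurableType d) (E : spectral_measure H T) (x : H).

Definition scalar_measure (D : set T) : \bar R :=
  (complex.Re (hdot H (E D x) x))%:E.

Let hdot_spm (D : set T) : hdot H (E D x) x = `|E D x| ^+ 2.
Proof.
by rewrite hdot_norm; have [sa id] := spm_proj E D; rewrite -{1}id sa.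
Qed.

Let scalar_measure0 : scalar_measure set0 = 0%E.
Proof. by rewrite /scalar_measure hdot_spm spm0 normr0 expr0n. Qed.

Let scalar_measure_ge0 D : (0 <= scalar_measure D)%E.
Proof.
rewrite /scalar_measure lee_fin hdot_spm.
have : 0 <= `|E D x| ^+ 2 by exact: exprn_ge0.
by rewrite lecE => /andP[].
Qed.

Let cauchy_schwarz (u v : H) : `|hdot H u v| <= `|u| * `|v|.
Proof.
have [->|v0] := eqVneq v 0; first by rewrite linear0r !normr0 mulr0.
have vv0 : 0 < hdot H v v by rewrite dnorm_gt0.
rewrite -ler_sqr ?nnegrE ?mulr_ge0 ?normr_ge0// exprMn !hdot_norm.
have := dnorm_ge0 (hdot H) (hdot H v v *: u - hdot H u v *: v).
rewrite dnormB !dnormZ linearZl_LR linearZr_LR /=.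
have -> : (hdot H u v)^* * hdot H u v = `|hdot H u v| ^+ 2.
  by rewrite mulrC -normCK.
have vvr : (hdot H v v)^* = hdot H v v by apply/conj_Creal/ger0_real/ltW.
rewrite rmorphM /= vvr conj_Creal; last by apply: ger0_real; rewrite exprn_ge0.
rewrite (ger0_norm (ltW vv0)) => h.
rewrite -subr_ge0 -(pmulr_rge0 _ vv0).
apply: (le_trans h); rewrite le_eqVlt; apply/orP; left; apply/eqP; ring.
Qed.

Let scalar_measure_sigma_additive : semi_sigma_additive scalar_measure.
Proof.
move=> F mF tF mUF.
pose g (v : H) : R := complex.Re (hdot H v x).
have gB u v : g (u - v) = g u - g v by rewrite /g linearBl raddfB.
have -> : (fun n => \sum_(0 <= i < n) scalar_measure (F i))%E =
    (fun n => (g (series (fun i => E (F i) x) n))%:E).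
  apply/funext => n; rewrite sumEFin; congr (_%:E).
  rewrite /series /=; elim/big_rec2: _ => [|i a b _ ->].
    by rewrite /g linear0l.
  by rewrite /g linearDl raddfD.
apply: cvg_EFin; first by near=> n.
rewrite /comp /=.
have Ex : series (fun i => E (F i) x) @ \oo --> E (\bigcup_i F i) x.
  exact: spm_sigma_additive.
apply/cvgrPdist_lt => e e0.
have e'0 : 0 < (e%:C / (`|x| + 1)).
  by rewrite divr_gt0 ?ltcR// ltr_wpDl.
move/cvgrPdist_lt : Ex => /(_ _ e'0).
apply: filterS => n /= hn.
rewrite -gB -ltcR; apply: le_lt_trans (normc_ge_Re _) _.
apply: le_lt_trans (cauchy_schwarz _ _) _.
move: hn; rewrite ltr_pdivlMr ?ltr_wpDl// => hn; apply: le_lt_trans hn.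
by rewrite ler_wpM2l// lerDl.
Unshelve. all: by end_near. Qed.

HB.instance Definition _ := isMeasure.Build d T R scalar_measure
  scalar_measure0 scalar_measure_ge0 scalar_measure_sigma_additive.

End scalar_measure.

(* [S] is the operator [\int_D f dE], determined by its quadratic form. *)
Definition spectral_integral (R : realType) (H : hilbertSpace R)
    (d : measure_display) (T : measurableType d) (E : spectral_measure H T)
    (D : set T) (f : T -> R) (S : H -> H) : Prop :=
  forall x, (scalar_measure E x).-integrable D (EFin \o f) /\
    hdot H (S x) x = (\int[scalar_measure E x]_(t in D) f t)%:C.

Section functional_calculus.
Context (R : realType) (n : nat) (H : hilbertSpace R).

Definition commuting_self_adjoint_tuple (A : 'I_n -> {linear H -> H}) : Prop :=
  (forall j, bounded_op (A j) /\ self_adjoint (A j)) /\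
  (forall j k x, A j (A k x) = A k (A j x)).

(* [Ej j] is the spectral measure of [A j] on the line, and [E] is their
   product: E(D_1 x ... x D_n) = E_1(D_1) ... E_n(D_n) on Borel boxes. For a
   commuting self-adjoint tuple such an [E] exists and is unique by the
   spectral theorem; it is kept as a relation here. *)
Definition is_joint_spectral_measure (A : 'I_n -> {linear H -> H})
    (E : spectral_measure H (borel_rV R n)) : Prop :=
  exists Ej : 'I_n -> spectral_measure H (measurableTypeR R),
    (forall j, spectral_integral (Ej j) setT idfun (A j)) /\
    (forall D : 'I_n -> set (measurableTypeR R), (forall j, measurable (D j)) ->
       forall x, E [set s : 'rV[R]_n | forall j, D j (s ord0 j)] x =
                 (\big[comp/idfun]_(j < n) (Ej j (D j) : H -> H)) x).

Definition spm_support (E : spectral_measure H (borel_rV R n)) : set 'rV[R]_n :=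
  [set s | forall V : set 'rV[R]_n, open V -> V s -> exists x, E V x != 0].

Definition joint_spectrum (A : 'I_n -> {linear H -> H}) : set 'rV[R]_n :=
  [set s | exists E, is_joint_spectral_measure A E /\ spm_support E s].

(* [S] is [f(A)], the integral of [f] over the joint spectrum (the support of
   the joint spectral measure [E]) with respect to [E]. *)
Definition is_functional_calculus (A : 'I_n -> {linear H -> H})
    (f : 'rV[R]_n -> R) (S : {linear H -> H}) : Prop :=
  exists E, is_joint_spectral_measure A E /\
    spectral_integral E (spm_support E) f S.

End functional_calculus.

Definition operator_monotone (R : realType) (n : nat) (U : set 'rV[R]_n)
    (f : 'rV[R]_n -> R) : Prop :=
  {within U, continuous f} /\
  (forall (H : hilbertSpace R) (A B : 'I_n -> {linear H -> H}),
     commuting_self_adjoint_tuple A -> commuting_self_adjoint_tuple B ->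
     joint_spectrum A `|` joint_spectrum B `<=` U ->
     (forall j, op_le (A j) (B j)) ->
     forall fA fB : {linear H -> H},
       is_functional_calculus A f fA -> is_functional_calculus B f fB ->
       op_le fA fB).

(* Main.v *)
Require Import Defs.
From mathcomp Require Import all_boot all_order all_algebra.
From mathcomp Require Import complex ring lra.
From mathcomp Require Import all_classical all_reals all_analysis.
From mathcomp Require Import measurable_realfun.

Set Implicit Arguments.
Unset Strict Implicit.
Unset Printing Implicit Defensive.

Import Order.TTheory GRing.Theory Num.Theory.
Import numFieldNormedType.Exports.

Local Open Scope classical_set_scope.
Local Open Scope complex_scope.
Local Open Scope ring_scope.

(** The kernel of the class Q^alpha is the inverse of a power of a product of
affine functions, so the heart of the matter is that, for two commuting tuples
of positive operators with A_j <= B_j and for 0 <= t <= 1/n,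
  (A_1 ... A_n)^t <= (B_1 ... B_n)^t.
This comes from an argument of Pedersen for the Loewner-Heinz inequality. If
P_1 <= Q_1 and P_2 <= Q_2, where P_1 commutes with P_2 and Q_1 with Q_2, then
P_i^(1/2) Q_i^(-1/2) is a contraction for i = 1, 2; hence so is
  Q_2^(-1/2) (P_1 P_2)^(1/2) Q_1^(-1/2),
which is similar to the self-adjoint operator
  (Q_1 Q_2)^(-1/4) (P_1 P_2)^(1/2) (Q_1 Q_2)^(-1/4).
The powers of the latter are therefore bounded, and a power-bounded self-adjoint
operator is a contraction ([power_bounded_contraction]), which says that
(P_1 P_2)^(1/2) <= (Q_1 Q_2)^(1/2) ([form_le_geomean]). Thus the set of exponents
(t_1, ..., t_n) for which A^t <= B^t is stable under midpoints; being closed and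
containing 0 and the coordinate vectors, it contains (t, ..., t) whenever
0 <= n t <= 1 ([form_le_interpolation], [form_le_prod_powR]).

Inversion reverses operator inequalities ([form_le_inv]). Applied to
the tuples xi_j + A_j and xi_j + B_j, this makes the kernel antitone for each xi;
integrating against tau and adding gamma times the identity gives
(1/f)(A) >= (1/f)(B), and a second inversion gives f(A) <= f(B)
([class_Q_form_le]).

These steps need a functional calculus only for operators with finitely many
eigenvalues, where it is the algebra of the sums of phi_k P_k over a finite
resolution of the identity P. The general case reduces to that one. The support
of the joint spectral measure is a compact subset of the open orthant
([compact_spm_support]); a grid of small mesh splits it into cells, and rounding
each coordinate down to the lower corner of its cell in A, and up to the upper
corner in B, produces tuples with finite spectrum A' <= A and B <= B' for which
f(A') and f(B') are uniformly close to f(A) and f(B), by uniform continuity of f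
near the support ([discretization]). *)

(** * Power-bounded self-adjoint operators *)

(** The ratios of consecutive terms of a log-convex sequence are nondecreasing,
so as soon as the first one exceeds 1 the sequence grows geometrically. *)
Lemma log_convex_bounded_le (R : realType) (u : nat -> R) (C : R) :
  (forall m, 0 <= u m) -> (forall m, u m.+1 ^+ 2 <= u m * u m.+2) ->
  (forall m, u m <= C) -> u 1%N <= u 0%N.
Proof.
move=> u_ge0 u_cvx u_bnd; rewrite leNgt; apply/negP => u01.
have u0_gt0 : 0 < u 0%N.
  rewrite lt0r u_ge0 andbT; apply/eqP => u00.
  have := u_cvx 0%N; rewrite u00 mul0r => h.
  by have := exprn_gt0 2 (le_lt_trans (u_ge0 0%N) u01); rewrite ltNge h.
pose q := u 1%N / u 0%N.
have q1 : 1 < q by rewrite ltr_pdivlMr// mul1r.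
have q0 : 0 < q by exact: lt_trans q1.
have ratio m : 0 < u m /\ q * u m <= u m.+1.
  elim: m => [|m [um_gt0 IH]]; first by rewrite divfK ?gt_eqF.
  have um1_gt0 : 0 < u m.+1 by apply: lt_le_trans IH; rewrite mulr_gt0.
  split=> //; rewrite -(ler_pM2r um_gt0) -mulrA [u m.+1 * _]mulrC mulrA.
  apply: (@le_trans _ _ (u m.+1 ^+ 2)); first by rewrite expr2 ler_pM2r.
  by rewrite [_ * u m]mulrC u_cvx.
have geo m : q ^+ m * u 0%N <= u m.
  elim: m => [|m IH]; first by rewrite mul1r.
  rewrite exprS -mulrA; apply: le_trans (ratio m).2.
  by rewrite ler_pM2l.
have bern m : 1 + m%:R * (q - 1) <= q ^+ m.
  elim: m => [|m IH]; first by rewrite mul0r addr0.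
  rewrite exprS; apply: (@le_trans _ _ (q * (1 + m%:R * (q - 1)))).
    have m0 : 0 <= m%:R :> R by [].
    rewrite -subr_ge0 -natr1 (_ : _ - _ = m%:R * (q - 1) ^+ 2); last by ring.
    by rewrite mulr_ge0 ?sqr_ge0.
  by rewrite ler_pM2l.
have C0 : 0 <= C := le_trans (u_ge0 0%N) (u_bnd 0%N).
have qu0 : 0 < (q - 1) * u 0%N by rewrite mulr_gt0// subr_gt0.
pose m := (Num.truncn (C / ((q - 1) * u 0%N))).+1.
have hm : C < m%:R * ((q - 1) * u 0%N).
  by rewrite -ltr_pdivrMr// truncnS_gt.
have := le_trans (geo m) (u_bnd m); apply/negP; rewrite -ltNge.
apply: lt_le_trans hm _; rewrite mulrA ler_pM2r//.
by apply: le_trans (bern m); rewrite lerDr.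
Qed.

Section real_inner_product.
Context (R : realType) (H : hilbertSpace R).
Implicit Types x y z : H.

(** All the forms to be compared come from self-adjoint operators and are real, so
the real part of the inner product carries the inequalities and keeps them in the
totally ordered field [R]. *)
Definition rdot x y : R := complex.Re (hdot H x y).

Lemma rdotC x y : rdot x y = rdot y x.
Proof.
rewrite /rdot hermC expr0 mul1r.
have Re_conj (w : R[i]) : complex.Re (Num.conj w) = complex.Re w by case: w.
exact: Re_conj.
Qed.

Lemma rdotDl x y z : rdot (x + y) z = rdot x z + rdot y z.
Proof. by rewrite /rdot linearDl raddfD. Qed.

Lemma rdotBl x y z : rdot (x - y) z = rdot x z - rdot y z.
Proof. by rewrite /rdot linearBl raddfB. Qed.

Lemma rdot0l z : rdot 0 z = 0.
Proof. by rewrite /rdot linear0l. Qed.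

Lemma rdotZl (a : R) x z : rdot (a%:C *: x) z = a * rdot x z.
Proof.
have ReZ (w : R[i]) : complex.Re (a%:C * w) = a * complex.Re w.
  by case: w => u v /=; rewrite mul0r subr0.
by rewrite /rdot linearZl_LR /= ReZ.
Qed.

Lemma rdot_suml (I : finType) (F : I -> H) z :
  rdot (\sum_i F i) z = \sum_i rdot (F i) z.
Proof. by apply: (big_morph (rdot^~ z)) => [x y|]; rewrite ?rdotDl ?rdot0l. Qed.

Lemma rdotDr x y z : rdot z (x + y) = rdot z x + rdot z y.
Proof. by rewrite !(rdotC z) rdotDl. Qed.

Lemma rdotBr x y z : rdot z (x - y) = rdot z x - rdot z y.
Proof. by rewrite !(rdotC z) rdotBl. Qed.

Lemma rdotZr (a : R) x z : rdot z (a%:C *: x) = a * rdot z x.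
Proof. by rewrite !(rdotC z) rdotZl. Qed.

Lemma rdot_sumr (I : finType) (F : I -> H) z :
  rdot z (\sum_i F i) = \sum_i rdot z (F i).
Proof. by rewrite rdotC rdot_suml; under eq_bigr do rewrite rdotC. Qed.

Lemma hdotxx x : hdot H x x = (rdot x x)%:C.
Proof. by rewrite /rdot RRe_real// ger0_real// -hdot_norm exprn_ge0. Qed.

Lemma rdot_ge0 x : 0 <= rdot x x.
Proof. by rewrite -lecR -hdotxx -hdot_norm exprn_ge0. Qed.

Lemma rdot_eq0 x : rdot x x = 0 -> x = 0.
Proof.
move=> x0; apply/eqP; rewrite -normr_eq0 -sqrf_eq0.
by rewrite hdot_norm hdotxx x0.
Qed.

Lemma rdot_cauchy_schwarz x y : rdot x y ^+ 2 <= rdot x x * rdot y y.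
Proof.
have [y0|y0] := eqVneq (rdot y y) 0.
  by rewrite (rdot_eq0 y0) rdotC !rdot0l expr0n mulr0.
have yy0 : 0 < rdot y y by rewrite lt0r y0 rdot_ge0.
have := rdot_ge0 ((rdot y y)%:C *: x - (rdot x y)%:C *: y).
rewrite rdotBl !rdotBr !rdotZl !rdotZr (rdotC y x) => h.
rewrite -subr_ge0 -(pmulr_rge0 _ yy0); apply: le_trans h _.
by rewrite le_eqVlt; apply/orP; left; apply/eqP; ring.
Qed.

(** [|Y v|^2 = <X Y v, v> <= |Y v| |v|]. *)
Lemma contraction_adjoint (X Y : H -> H) :
  (forall u, rdot (X u) (X u) <= rdot u u) ->
  (forall u v, rdot (X u) v = rdot u (Y v)) ->
  forall v, rdot (Y v) (Y v) <= rdot v v.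
Proof.
move=> Xc XY v; have [->|Y0] := eqVneq (rdot (Y v) (Y v)) 0.
  exact: rdot_ge0.
have Y_gt0 : 0 < rdot (Y v) (Y v) by rewrite lt0r Y0 rdot_ge0.
rewrite -(ler_pM2l Y_gt0) -expr2 -{1}XY.
by apply: le_trans (rdot_cauchy_schwarz _ _) _; rewrite ler_wpM2r ?rdot_ge0.
Qed.

(** This does the work of the spectral radius formula: for [S] self-adjoint,
[|S^(m+1) x|^2 = <S^m x, S^(m+2) x>], so [|S^m x|^2] is log-convex in [m] by
Cauchy-Schwarz. *)
Lemma power_bounded_contraction (S : H -> H) (C : R) :
  (forall u v, rdot (S u) v = rdot u (S v)) ->
  forall x, (forall m, rdot (iter m S x) (iter m S x) <= C) ->
  rdot (S x) (S x) <= rdot x x.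
Proof.
move=> Ssa x Sbnd.
apply: (@log_convex_bounded_le _ (fun m => rdot (iter m S x) (iter m S x)) C).
- by move=> m; exact: rdot_ge0.
- by move=> m; rewrite {1}iterS Ssa; exact: rdot_cauchy_schwarz.
- exact: Sbnd.
Qed.

End real_inner_product.

(** * Operators diagonal in a finite resolution of the identity *)

Section resolution.
Context (R : realType) (H : hilbertSpace R) (I : finType)
  (P : I -> {linear H -> H}).

Definition resolution : Prop :=
  [/\ forall k x y, rdot (P k x) y = rdot x (P k y),
      forall k l x, P k (P l x) = if k == l then P k x else 0 &
      forall x, \sum_k P k x = x].

(** [diag_op phi] is [phi] of the operator whose eigenprojections are the [P k]:
the functional calculus of a finite spectrum, and an algebra morphism in [phi]
by [diag_opM] and [diag_op1]. *)
Definition diag_op (phi : I -> R) (x : H) : H := \sum_k (phi k)%:C *: P k x.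

Definition diag_form (phi : I -> R) (x : H) : R :=
  \sum_k phi k * rdot (P k x) x.

Lemma eq_diag_op phi psi x : phi =1 psi -> diag_op phi x = diag_op psi x.
Proof. by move=> e; apply: eq_bigr => k _; rewrite e. Qed.

Lemma eq_diag_form phi psi x : phi =1 psi -> diag_form phi x = diag_form psi x.
Proof. by move=> e; apply: eq_bigr => k _; rewrite e. Qed.

Lemma diag_form_op phi x : rdot (diag_op phi x) x = diag_form phi x.
Proof. by rewrite rdot_suml; under eq_bigr do rewrite rdotZl. Qed.

Hypothesis resP : resolution.

Lemma diag_op_sa phi x y : rdot (diag_op phi x) y = rdot x (diag_op phi y).
Proof.
have [sa _ _] := resP; rewrite rdot_suml rdot_sumr.
by apply: eq_bigr => k _; rewrite rdotZl rdotZr sa.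
Qed.

Lemma diag_opM phi psi x :
  diag_op phi (diag_op psi x) = diag_op (fun k => phi k * psi k) x.
Proof.
have [_ orth _] := resP; apply: eq_bigr => k _.
rewrite linear_sum (bigD1 k)//= big1 => [|l lk].
  by rewrite addr0 linearZ/= orth eqxx scalerA -rmorphM.
by rewrite linearZ /= orth eq_sym (negPf lk) scaler0.
Qed.

Lemma diag_op1 x : diag_op (fun=> 1) x = x.
Proof.
have [_ _ tot] := resP; rewrite -[RHS]tot.
by apply: eq_bigr => k _; rewrite scale1r.
Qed.

Lemma diag_opK phi psi x : (forall k, phi k * psi k = 1) ->
  diag_op phi (diag_op psi x) = x.
Proof. by move=> e; rewrite diag_opM (eq_diag_op _ e) diag_op1. Qed.

Lemma proj_rdot k x : rdot (P k x) x = rdot (P k x) (P k x).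
Proof. by have [sa orth _] := resP; rewrite -[RHS]sa orth eqxx. Qed.

Lemma proj_rdot_ge0 k x : 0 <= rdot (P k x) x.
Proof. by rewrite proj_rdot rdot_ge0. Qed.

Lemma sum_proj_rdot x : \sum_k rdot (P k x) x = rdot x x.
Proof. by have [_ _ tot] := resP; rewrite -rdot_suml tot. Qed.

Lemma diag_op_sq phi x :
  rdot (diag_op phi x) (diag_op phi x) = diag_form (fun k => phi k ^+ 2) x.
Proof.
rewrite -diag_op_sa diag_opM diag_form_op.
by apply: eq_diag_form => k; rewrite expr2.
Qed.

Lemma diag_op_bound phi x :
  rdot (diag_op phi x) (diag_op phi x) <= (\sum_k phi k ^+ 2) * rdot x x.
Proof.
rewrite diag_op_sq mulr_suml; apply: ler_sum => k _.
rewrite ler_wpM2l ?sqr_ge0// -(sum_proj_rdot x) (bigD1 k)//= lerDl.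
by apply: sumr_ge0 => l _; exact: proj_rdot_ge0.
Qed.

End resolution.

(** * Geometric means and inverses *)

Section two_resolutions.
Context (R : realType) (H : hilbertSpace R) (I J : finType)
  (P : I -> {linear H -> H}) (Q : J -> {linear H -> H})
  (resP : resolution P) (resQ : resolution Q).

Definition form_le (phi : I -> R) (psi : J -> R) : Prop :=
  forall x, diag_form P phi x <= diag_form Q psi x.

Lemma eq_form_le phi phi' psi psi' :
  phi =1 phi' -> psi =1 psi' -> form_le phi psi -> form_le phi' psi'.
Proof.
by move=> e e' h x; rewrite -(eq_diag_form _ _ e) -(eq_diag_form _ _ e').
Qed.

(** Monotonicity of the geometric mean of commuting operators. Writing the
smaller operators as squares and the larger ones as fourth powers makes all the
roots in the argument of Pedersen explicit, and leaves only field identities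
between coefficients to check. *)
Lemma form_le_geomean (p1 p2 : I -> R) (q1 q2 : J -> R) :
  (forall l, 0 < q1 l) -> (forall l, 0 < q2 l) ->
  form_le (fun k => p1 k ^+ 2) (fun l => q1 l ^+ 4) ->
  form_le (fun k => p2 k ^+ 2) (fun l => q2 l ^+ 4) ->
  form_le (fun k => p1 k * p2 k) (fun l => q1 l ^+ 2 * q2 l ^+ 2).
Proof.
move=> q1_gt0 q2_gt0 le1 le2.
have q1_neq0 l : q1 l != 0 by rewrite gt_eqF.
have q2_neq0 l : q2 l != 0 by rewrite gt_eqF.
pose r1 l := (q1 l ^+ 2)^-1; pose r2 l := (q2 l ^+ 2)^-1.
(* [P^(1/2) Q^(-1/2)] is a contraction when [P <= Q]. *)
have X_contr p q : (forall l, 0 < q l) ->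
    form_le (fun k => p k ^+ 2) (fun l => q l ^+ 4) ->
    forall u, let X := diag_op P p (diag_op Q (fun l => (q l ^+ 2)^-1) u) in
    rdot X X <= rdot u u.
  move=> q_gt0 le u /=; rewrite diag_op_sq//; apply: le_trans (le _) _.
  rewrite -diag_form_op !diag_op_sa// !diag_opM//.
  rewrite (@eq_diag_op _ _ _ _ _ (fun=> 1)) ?diag_op1// => l.
  by have := q_gt0 l; rewrite lt0r => /andP[? _]; field.
have X1 := X_contr _ _ q1_gt0 le1.
have X2 : forall v, let Y := diag_op Q r2 (diag_op P p2 v) in
    rdot Y Y <= rdot v v.
  apply: contraction_adjoint (X_contr _ _ q2_gt0 le2) _ => u v.
  by rewrite !diag_op_sa.
pose T u := diag_op Q r2 (diag_op P p2 (diag_op P p1 (diag_op Q r1 u))).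
have T_contr u : rdot (T u) (T u) <= rdot u u by apply: le_trans (X2 _) _.
(* [S] is similar to [T], through the diagonal operator [w']. *)
pose w l := q1 l / q2 l; pose w' l := q2 l / q1 l.
pose c l := (q1 l * q2 l)^-1.
pose G := diag_op P (fun k => p1 k * p2 k).
pose S u := diag_op Q c (G (diag_op Q c u)).
have S_sa u v : rdot (S u) v = rdot u (S v) by rewrite !diag_op_sa.
have ST u : S (diag_op Q w' u) = diag_op Q w' (T u).
  rewrite /S /T !diag_opM//; congr (diag_op Q _ _).
    by apply/funext => l; rewrite /c /w' /r2; field; rewrite q1_neq0 q2_neq0.
  rewrite /G (_ : (fun k => p2 k * p1 k) = (fun k => p1 k * p2 k)).
    congr (diag_op P _ (diag_op Q _ _)); apply/funext => l.
    by rewrite /c /w' /r1; field; rewrite q1_neq0 q2_neq0.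
  by apply/funext => k; rewrite mulrC.
have iterST m u : iter m S u = diag_op Q w' (iter m T (diag_op Q w u)).
  elim: m => [|m IH]; last by rewrite !iterS IH ST.
  by rewrite /= diag_opK// => l; rewrite /w /w'; field; rewrite q1_neq0 q2_neq0.
have T_iter m u : rdot (iter m T u) (iter m T u) <= rdot u u.
  by elim: m => [//|m IH]; rewrite iterS; apply: le_trans (T_contr _) IH.
have S_contr u : rdot (S u) (S u) <= rdot u u.
  apply: (@power_bounded_contraction _ _ _
    ((\sum_l w' l ^+ 2) * rdot (diag_op Q w u) (diag_op Q w u))) => // m.
  rewrite iterST; apply: le_trans (diag_op_bound resQ _ _) _.
  by rewrite ler_wpM2l// sumr_ge0// => l _; rewrite sqr_ge0.
(* Undo the two outer factors of [S]: [<S y, y> <= <y, y>] at [y = c^-1 x]. *)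
move=> x; pose y := diag_op Q (fun l => q1 l * q2 l) x.
have xE : x = diag_op Q c y.
  by rewrite /y diag_opK// => l; rewrite /c; field; rewrite q1_neq0 q2_neq0.
rewrite -diag_form_op {2}xE -[rdot _ _]diag_op_sa// {1}xE -/(S y).
have -> : diag_form Q (fun l => q1 l ^+ 2 * q2 l ^+ 2) x = rdot y y.
  by rewrite diag_op_sq//; apply: eq_diag_form => l; rewrite exprMn.
have := rdot_cauchy_schwarz (S y) y => cs.
have {}cs : rdot (S y) y ^+ 2 <= rdot y y ^+ 2.
  by apply: le_trans cs _; rewrite expr2 ler_wpM2r ?rdot_ge0.
have := rdot_ge0 y; move: (rdot y y) (rdot (S y) y) cs => a b ab a0.
by apply: le_trans (ler_norm b) _; rewrite -(ger0_norm a0) -ler_sqr ?nnegrE// !real_normK ?num_real.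
Qed.

(** With [y = psi(Q)^-1 x] and [z = phi(P)^-1 x], expand
[0 <= <phi(P) (y - z), y - z>]: the cross terms are [<x, y>], and
[<phi(P) y, y> <= <psi(Q) y, y> = <x, y>]. *)
Lemma form_le_inv (phi : I -> R) (psi : J -> R) :
  (forall k, 0 < phi k) -> (forall l, 0 < psi l) ->
  form_le phi psi ->
  forall x, diag_form Q (fun l => (psi l)^-1) x <=
            diag_form P (fun k => (phi k)^-1) x.
Proof.
move=> phi_gt0 psi_gt0 le x.
pose y := diag_op Q (fun l => (psi l)^-1) x.
pose z := diag_op P (fun k => (phi k)^-1) x.
have Py : diag_op Q psi y = x.
  by rewrite diag_opK// => l; rewrite divff// gt_eqF.
have Pz : diag_op P phi z = x.
  by rewrite diag_opK// => k; rewrite divff// gt_eqF.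
have pos : 0 <= rdot (diag_op P phi (y - z)) (y - z).
  rewrite diag_form_op; apply: sumr_ge0 => k _.
  by rewrite mulr_ge0 ?proj_rdot_ge0// ltW.
rewrite -!diag_form_op -/y -/z.
have : 0 <= rdot (diag_op P phi y) y - rdot x y *+ 2 + rdot z x.
  apply: le_trans pos _.
  rewrite diag_op_sa// rdotBl.
  have e : diag_op P phi (y - z) = diag_op P phi y - x.
    rewrite -[in RHS]Pz /diag_op -sumrB; apply: eq_bigr => k _.
    by rewrite linearB scalerBr.
  rewrite e !rdotBr -(diag_op_sa resP phi z y) Pz (rdotC y (diag_op _ _ _)).
  rewrite (rdotC y x) mulr2n.
  lra.
have := le y; rewrite -!diag_form_op Py (rdotC y x) => h1 h2.
lra.
Qed.

End two_resolutions.

(** * Products of powers *)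

(** Bisection: [D] meets every interval of the dyadic subdivisions around [t] in
its two endpoints. *)
Lemma midpoint_convex_dense (R : realType) (D : R -> Prop) :
  D 0 -> D 1 -> (forall s t, D s -> D t -> D ((s + t) / 2)) ->
  forall t, 0 <= t <= 1 -> forall e, 0 < e ->
  exists2 s, D s & `|t - s| < e.
Proof.
move=> D0 D1 Dmid t t01 e e0.
have bisect m : exists l r, [/\ D l, D r, l <= t, t <= r & r - l = 2 ^- m].
  elim: m => [|m [l [r [Dl Dr lt tr rl]]]].
    by exists 0, 1; case/andP: t01 => ? ?; split => //; rewrite subr0 expr0 invr1.
  have mE : r - l = 2 * 2 ^- m.+1.
    by rewrite rl exprS invfM mulrA divff// mul1r.
  have [tm|mt] := leP t ((l + r) / 2).
    by exists l, ((l + r) / 2); split => //; [exact: Dmid|lra].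
  by exists ((l + r) / 2), r; split => //; [exact: Dmid|exact: ltW|lra].
have [m _ /(_ m (leqnn m)) me] := near_infty_natSinv_expn_lt (PosNum e0).
have [l [r [Dl _ lt tr rl]]] := bisect m.
exists l => //; rewrite ger0_norm ?subr_ge0//; apply: le_lt_trans (me).
by rewrite div1r -rl lerD2r.
Qed.

Lemma geomean_continuous (R : realType) (a b : R) : 0 < a -> 0 < b ->
  continuous (fun t : R => a `^ (1 - t) * b `^ t).
Proof.
move=> a0 b0.
have -> : (fun t : R => a `^ (1 - t) * b `^ t) =
    (@expR R) \o (fun t : R => t * (ln b - ln a) + ln a).
  apply/funext => t /=; rewrite /powR !gt_eqF// -expRD; congr expR; ring.
move=> t; apply: continuous_comp; last exact: continuous_expR.
apply: cvgD; last exact: cvg_cst.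
exact: mulrr_continuous.
Qed.

Section interpolation.
Context (R : realType) (H : hilbertSpace R) (I J : finType)
  (P : I -> {linear H -> H}) (Q : J -> {linear H -> H})
  (resP : resolution P) (resQ : resolution Q).

Let mean (a b t : R) : R := a `^ (1 - t) * b `^ t.

Let mean_gt0 (a b t : R) : 0 < a -> 0 < b -> 0 < mean a b t.
Proof. by move=> a0 b0; rewrite mulr_gt0// powR_gt0. Qed.

Let sqrt_mean (a b s t : R) : 0 < a -> 0 < b ->
  Num.sqrt (mean a b s) * Num.sqrt (mean a b t) = mean a b ((s + t) / 2).
Proof.
move=> a0 b0; rewrite -!powR12_sqrt ?ltW ?mean_gt0// -powRM ?ltW ?mean_gt0//.
rewrite /mean mulrACA -!powRD ?(gt_eqF a0) ?(gt_eqF b0) ?implybT//.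
rewrite powRM ?powR_ge0// -!powRrM.
by have -> : (1 - s + (1 - t)) / 2 = 1 - (s + t) / 2 by field.
Qed.

(** The exponents [t] for which the conclusion holds are stable under midpoints by
[form_le_geomean], contain 0 and 1, and form a closed set since the quadratic
forms are continuous in [t]. *)
Lemma form_le_interpolation (phi1 phi2 : I -> R) (psi1 psi2 : J -> R) (t : R) :
  0 <= t <= 1 ->
  (forall k, 0 < phi1 k) -> (forall k, 0 < phi2 k) ->
  (forall l, 0 < psi1 l) -> (forall l, 0 < psi2 l) ->
  form_le P Q phi1 psi1 -> form_le P Q phi2 psi2 ->
  form_le P Q (fun k => phi1 k `^ (1 - t) * phi2 k `^ t)
              (fun l => psi1 l `^ (1 - t) * psi2 l `^ t).
Proof.
move=> t01 phi1_gt0 phi2_gt0 psi1_gt0 psi2_gt0 le1 le2.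
pose D s := form_le P Q (fun k => mean (phi1 k) (phi2 k) s)
                        (fun l => mean (psi1 l) (psi2 l) s).
have D0 : D 0.
  apply: eq_form_le le1 => k; rewrite /mean subr0 powRr0 mulr1 powRr1//;
  exact/ltW.
have D1 : D 1.
  apply: eq_form_le le2 => k; rewrite /mean subrr powRr0 mul1r powRr1//;
  exact/ltW.
have Dmid s u : D s -> D u -> D ((s + u) / 2).
  move=> Ds Du.
  pose p v k := Num.sqrt (mean (phi1 k) (phi2 k) v).
  pose q v l := Num.sqrt (Num.sqrt (mean (psi1 l) (psi2 l) v)).
  have pE v k : p v k ^+ 2 = mean (phi1 k) (phi2 k) v.
    by rewrite sqr_sqrtr// ltW// mean_gt0.
  have q2E v l : q v l ^+ 2 = Num.sqrt (mean (psi1 l) (psi2 l) v).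
    by rewrite sqr_sqrtr// sqrtr_ge0.
  have q4E v l : q v l ^+ 4 = mean (psi1 l) (psi2 l) v.
    by rewrite (exprM _ 2 2) q2E sqr_sqrtr// ltW// mean_gt0.
  have q_gt0 v l : 0 < q v l by rewrite !sqrtr_gt0 mean_gt0.
  have := @form_le_geomean _ _ _ _ _ _ resP resQ (p s) (p u) (q s) (q u)
    (q_gt0 s) (q_gt0 u).
  move=> /(_ (eq_form_le (fsym (pE s)) (fsym (q4E s)) Ds)).
  move=> /(_ (eq_form_le (fsym (pE u)) (fsym (q4E u)) Du)).
  by apply: eq_form_le => k; rewrite ?q2E sqrt_mean.
move=> x; rewrite leNgt; apply/negP => lt.
pose F s := diag_form Q (fun l => mean (psi1 l) (psi2 l) s) x -
            diag_form P (fun k => mean (phi1 k) (phi2 k) s) x.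
have form_cont (K : finType) (f1 f2 : K -> R) (N : K -> {linear H -> H}) :
    (forall k, 0 < f1 k) -> (forall k, 0 < f2 k) ->
    continuous (fun s => diag_form N (fun k => mean (f1 k) (f2 k) s) x).
  move=> f1_gt0 f2_gt0 s; apply: cvg_big => [|k _]; first exact: add_continuous.
  apply: cvgMr_tmp.
  exact: geomean_continuous.
have F_cont : continuous F.
  by move=> s; apply: cvgB; exact: form_cont.
have Ft : F t < 0 by rewrite subr_lt0.
have /cvgrPdist_lt/(_ (- F t)) := F_cont t.
rewrite oppr_gt0 => /(_ Ft)/nbhs_ballP[e /= e0 He].
have [s Ds ts] := midpoint_convex_dense D0 D1 Dmid t01 e0.
have := He s ts; have : 0 <= F s by rewrite subr_ge0; exact: Ds.
move=> Fs; rewrite distrC => h.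
have := le_lt_trans (ler_norm _) h; lra.
Qed.

(** Peel off one factor at a time:
[(a_0 ... a_m)^t = ((a_0 ... a_(m-1))^u)^(1-t) a_m^t] with [u = t / (1 - t)], and
[m u <= 1] because [(m + 1) t <= 1]. The exponent [t = 1], which forces [m = 0],
is treated apart. *)
Lemma form_le_prod_powR (m : nat) (phi : 'I_m -> I -> R) (psi : 'I_m -> J -> R)
    (t : R) :
  0 <= t -> m%:R * t <= 1 ->
  (forall j k, 0 < phi j k) -> (forall j l, 0 < psi j l) ->
  (forall j, form_le P Q (phi j) (psi j)) ->
  form_le P Q (fun k => (\prod_j phi j k) `^ t)
              (fun l => (\prod_j psi j l) `^ t).
Proof.
elim: m phi psi t => [|m IH] phi psi t t0 mt phi_gt0 psi_gt0 le x.
  have e (K : finType) (f : 'I_0 -> K -> R) :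
      (fun k => (\prod_j f j k) `^ t) =1 fun=> 1.
    by move=> k; rewrite big_ord0 powR1.
  rewrite (eq_diag_form _ _ (e _ phi)) (eq_diag_form _ _ (e _ psi)).
  by rewrite -!diag_form_op !diag_op1.
have t1 : t <= 1.
  by apply: le_trans mt; rewrite ler_peMl// ler1n.
have prod_gt0 (K : finType) (f : 'I_m.+1 -> K -> R) k :
    (forall j k, 0 < f j k) ->
    0 < \prod_(j < m) f (widen_ord (leqnSn m) j) k.
  by move=> f_gt0; apply: prodr_gt0.
have [t1'|t1'] := eqVneq t 1.
  have m0 : m = 0%N.
    move: mt; rewrite t1' mulr1 lern1 ltnS leqn0 => /eqP//.
  subst m; have := le ord0 x; rewrite t1'.
  have e (K : finType) (f : 'I_1 -> K -> R) : (forall j k, 0 < f j k) ->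
      f ord0 =1 (fun k => (\prod_j f j k) `^ 1).
    by move=> f_gt0 k; rewrite big_ord1 powRr1// ltW.
  by rewrite (eq_diag_form _ _ (e _ phi phi_gt0))
             (eq_diag_form _ _ (e _ psi psi_gt0)).
have t1_gt0 : 0 < 1 - t by rewrite subr_gt0 lt_neqAle t1'.
pose u := t / (1 - t).
have u0 : 0 <= u by rewrite divr_ge0// ltW.
have mu : m%:R * u <= 1.
  rewrite mulrA ler_pdivrMr// mul1r lerBrDr.
  by move: mt; rewrite -natr1 mulrDl mul1r.
have := IH (fun j => phi (widen_ord (leqnSn m) j))
  (fun j => psi (widen_ord (leqnSn m) j)) u u0 mu
  (fun j => phi_gt0 _) (fun j => psi_gt0 _) (fun j => le _).
have t01 : 0 <= t <= 1 by rewrite t0.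
move=> /(@form_le_interpolation _ _ _ _ _ t01) interp.
have := interp (phi ord_max) (psi ord_max)
  (fun k => powR_gt0 _ (prod_gt0 _ _ k phi_gt0)) (phi_gt0 _)
  (fun l => powR_gt0 _ (prod_gt0 _ _ l psi_gt0)) (psi_gt0 _) (le _) x.
have e (K : finType) (f : 'I_m.+1 -> K -> R) : (forall j k, 0 < f j k) ->
    (fun k => ((\prod_(j < m) f (widen_ord (leqnSn m) j) k) `^ u) `^ (1 - t)
              * f ord_max k `^ t) =1 (fun k => (\prod_j f j k) `^ t).
  move=> f_gt0 k; rewrite big_ord_recr/= powRM ?ltW ?prod_gt0//.
  by rewrite -powRrM divfK// gt_eqF.
by rewrite (eq_diag_form _ _ (e _ phi phi_gt0))
           (eq_diag_form _ _ (e _ psi psi_gt0)).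
Qed.

End interpolation.

(** * Functions of the class Q on tuples with finite spectrum *)

Section borel_rV_measurability.
Context (R : realType) (n : nat).
Implicit Types (A : set 'rV[R]_n).

Lemma open_borel_rV A : open A -> measurable (A : set (borel_rV R n)).
Proof. by move=> oA; apply: sub_sigma_algebra. Qed.

Lemma open_coord_gt (i : 'I_n) (r : R) : open [set s : 'rV[R]_n | r < s ord0 i].
Proof.
apply: (@open_comp _ _ (fun s : 'rV[R]_n => s ord0 i) [set t : R | r < t]).
  by move=> s _; exact: coord_continuous.
exact: open_gt.
Qed.

Lemma measurable_coord (i : 'I_n) :
  measurable_fun setT (fun s : borel_rV R n => (s : 'rV[R]_n) ord0 i).
Proof.
apply: (measurability _ (RGenOInfty.measurableE R)) => //.
move=> _ [_ [r ->] <-]; rewrite setTI; apply: open_borel_rV.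
rewrite (_ : _ @^-1` _ = [set s : 'rV[R]_n | r < s ord0 i]).
  exact: open_coord_gt.
by apply/seteqP; split => s /=; rewrite in_itv/= andbT.
Qed.

Lemma measurable_forall_coord (D : 'I_n -> set (measurableTypeR R)) :
  (forall i, measurable (D i)) ->
  measurable ([set s : 'rV[R]_n | forall i, D i (s ord0 i)] : set (borel_rV R n)).
Proof.
move=> mD.
rewrite (_ : mkset _ = \bigcap_(i in [set: 'I_n])
    [set s : borel_rV R n | D i ((s : 'rV[R]_n) ord0 i)]); last first.
  by apply/seteqP; split => [s Ds i _|s Ds i]; exact: Ds.
apply: fin_bigcap_measurable => // i _.
by have := @measurable_coord i measurableT _ (mD i); rewrite setTI.
Qed.

End borel_rV_measurability.

Section class_Q_form.
Context (R : realType) (n : nat) (alpha : R).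
Hypotheses (alpha_ge0 : 0 <= alpha) (nalpha : n%:R * alpha <= 1).

Let kern (xi z : 'rV[R]_n) : R :=
  ((\prod_(i < n) (xi ord0 i + z ord0 i)) `^ alpha)^-1.

Let kern_ge0 xi z : 0 <= kern xi z.
Proof. by rewrite invr_ge0 powR_ge0. Qed.

Let measurable_kern z (D : set (borel_rV R n)) :
  measurable_fun D (fun xi : borel_rV R n => kern xi z).
Proof.
apply: (@measurable_funS _ _ _ _ setT) => //.
rewrite (_ : (fun _ => _) = (fun xi : borel_rV R n =>
  (\prod_(i < n) ((xi : 'rV[R]_n) ord0 i + z ord0 i)) `^ (- alpha))).
  apply: (measurableT_comp (measurable_powR (- alpha))).
  apply: measurable_prod => i _; apply: measurable_funD => //.
  exact: measurable_coord.
by apply/funext => xi; rewrite /kern powRN.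
Qed.

Let measurable_toE (D : set (borel_rV R n)) (g : borel_rV R n -> R) :
  measurable_fun D g -> measurable_fun D (fun xi => (g xi)%:E).
Proof. by move=> mg; exact/measurable_EFinP. Qed.

Let measurable_nonneg_orthant :
  measurable (nonneg_orthant R n : set (borel_rV R n)).
Proof.
rewrite (_ : nonneg_orthant R n =
    [set s : 'rV[R]_n | forall i, `[0, +oo[%classic (s ord0 i)]).
  by apply: (@measurable_forall_coord _ _ (fun=> `[0, +oo[%classic)).
by apply/seteqP; split => s s0 i; have := s0 i; rewrite /= in_itv/= andbT.
Qed.

Context (H : hilbertSpace R) (I J : finType)
  (P : I -> {linear H -> H}) (Q : J -> {linear H -> H})
  (resP : resolution P) (resQ : resolution Q)
  (a : I -> 'rV[R]_n) (b : J -> 'rV[R]_n).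
Hypotheses (a_gt0 : forall k, positive_orthant R n (a k))
  (b_gt0 : forall l, positive_orthant R n (b l))
  (le_ab : forall j,
     form_le P Q (fun k => a k ord0 j) (fun l => b l ord0 j)).

Let kern_antitone xi : nonneg_orthant R n xi -> forall x,
  diag_form Q (fun l => kern xi (b l)) x <=
  diag_form P (fun k => kern xi (a k)) x.
Proof.
move=> xi0.
have term_gt0 (K : finType) (c : K -> 'rV[R]_n) :
    (forall k, positive_orthant R n (c k)) ->
    forall j k, 0 < xi ord0 j + c k ord0 j.
  by move=> c0 j k; apply: ltr_wpDl; [exact: xi0|exact: c0].
have kern_base_gt0 (K : finType) (c : K -> 'rV[R]_n) :
    (forall k, positive_orthant R n (c k)) ->
    forall k, 0 < (\prod_(i < n) (xi ord0 i + c k ord0 i)) `^ alpha.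
  by move=> c0 k; apply/powR_gt0/prodr_gt0 => i _; exact: term_gt0.
apply: form_le_inv => //; [exact: kern_base_gt0..|].
apply: (@form_le_prod_powR _ _ _ _ _ _ resP resQ n
  (fun j k => xi ord0 j + a k ord0 j) (fun j l => xi ord0 j + b l ord0 j)) => //.
- exact: term_gt0.
- exact: term_gt0.
move=> j x.
have shift (K : finType) (N : K -> {linear H -> H}) (c : K -> 'rV[R]_n) :
    resolution N ->
    diag_form N (fun k => xi ord0 j + c k ord0 j) x =
    xi ord0 j * rdot x x + diag_form N (fun k => c k ord0 j) x.
  move=> resN; rewrite -(sum_proj_rdot resN) mulr_sumr -big_split/=.
  by apply: eq_bigr => k _; rewrite mulrDl.
by rewrite !shift// lerD2l; exact: le_ab.
Qed.

(** The weights [<P k x, x>] are nonnegative and add up to [<x, x>]: the order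
between the kernels survives integration against [tau], and [gamma] contributes
[gamma <x, x>] to both sides. *)
Lemma class_Q_form_le (f : 'rV[R]_n -> R) :
  class_Q alpha (positive_orthant R n) f -> form_le P Q (f \o a) (f \o b).
Proof.
move=> [_ f_gt0 [gamma [tau fE]]].
pose integ z : \bar R :=
  (\int[tau]_(xi in nonneg_orthant R n) (kern xi z)%:E)%E.
have integE z : positive_orthant R n z -> integ z = ((f z)^-1 - gamma)%:E.
  move=> z0; have := fE z z0; rewrite -/(integ z).
  case: (integ z) => //= r [->].
  by rewrite addrAC subrr add0r.
have integ_form (K : finType) (N : K -> {linear H -> H}) (c : K -> 'rV[R]_n) x :
    resolution N -> (forall k, positive_orthant R n (c k)) ->
    (\int[tau]_(xi in nonneg_orthant R n)
      (diag_form N (fun k => kern xi (c k)) x)%:E)%E =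
    (diag_form N (fun k => (f (c k))^-1) x - gamma * rdot x x)%:E.
  move=> resN c0.
  under eq_integral => xi _ do rewrite /diag_form -sumEFin.
  rewrite ge0_integral_sum//=; last 2 first.
  - move=> k; apply: measurable_toE; apply: measurable_funM => //.
  - move=> k xi _; rewrite lee_fin mulr_ge0//; exact: proj_rdot_ge0.
  under eq_bigr => k _.
    under eq_integral => xi _ do rewrite mulrC EFinM.
    rewrite ge0_integralZl_EFin//=; last 3 first.
    - by move=> xi _; rewrite lee_fin.
    - exact: (measurable_toE (@measurable_kern _ _)).
    - exact: proj_rdot_ge0.
    rewrite -/(integ _) integE// -EFinM.
    over.
  rewrite sumEFin; congr (_%:E).
  rewrite /diag_form -(sum_proj_rdot resN) mulr_sumr -sumrB.
  by apply: eq_bigr => k _; rewrite mulrC mulrBl.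
have inv_le : form_le Q P (fun l => (f (b l))^-1) (fun k => (f (a k))^-1).
  move=> x; rewrite -(lerD2r (- (gamma * rdot x x))) -lee_fin -!integ_form//.
  apply: ge0_le_integral => //.
  - move=> xi _; rewrite lee_fin sumr_ge0// => l _.
    by rewrite mulr_ge0//; exact: proj_rdot_ge0.
  - apply: measurable_toE; apply: measurable_sum => l.
    by apply: measurable_funM.
  - apply: measurable_toE; apply: measurable_sum => l.
    by apply: measurable_funM.
  - by move=> xi xi0; rewrite lee_fin; exact: kern_antitone.
move=> x.
have := form_le_inv resQ resP _ _ inv_le x.
rewrite (@eq_diag_form _ _ _ P _ (f \o a)); last by move=> k; rewrite /= invrK.
rewrite (@eq_diag_form _ _ _ Q _ (f \o b)); last by move=> l; rewrite /= invrK.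
by apply => k; rewrite invr_gt0 f_gt0.
Qed.

End class_Q_form.

(** * Integration against a spectral measure *)

Section spectral_measure_theory.
Context (R : realType) (H : hilbertSpace R) (d : measure_display)
  (T : measurableType d) (E : spectral_measure H T).

Lemma scalar_measureE x D : scalar_measure E x D = (rdot (E D x) x)%:E.
Proof. by []. Qed.

Lemma spm_sa D x y : rdot (E D x) y = rdot x (E D y).
Proof. by have [sa _] := spm_proj E D; rewrite /rdot sa. Qed.

Lemma spm_idem D x : E D (E D x) = E D x.
Proof. by have [_] := spm_proj E D. Qed.

Lemma spm_rdot D x : rdot (E D x) x = rdot (E D x) (E D x).
Proof. by rewrite -spm_sa spm_idem. Qed.

Lemma spm_null D x : scalar_measure E x D = 0%E -> E D x = 0.
Proof. by rewrite scalar_measureE spm_rdot => -[/rdot_eq0]. Qed.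

Lemma spm_nullE D x : E D x = 0 -> scalar_measure E x D = 0%E.
Proof. by move=> D0; rewrite scalar_measureE D0 rdot0l. Qed.

(** Additivity of the scalar measures only gives [<E(D) x, x> + <E(~D) x, x> =
<x, x>]; since the two projections have orthogonal ranges, this forces the
remainder [x - E(~D) x - E(D) x] to have norm zero. *)
Lemma spm_setC D x : measurable D -> E (~` D) x = x - E D x.
Proof.
move=> mD; pose y := E (~` D) x + E D x.
have EDC z : E D (E (~` D) z) = 0.
  by rewrite -spmI ?setICr ?spm0//; exact: measurableC.
have cross : rdot (E (~` D) x) (E D x) = 0.
  by rewrite rdotC spm_sa EDC rdotC rdot0l.
have tot : rdot (E (~` D) x) x + rdot (E D x) x = rdot x x.
  have := @measureU _ _ _ (scalar_measure E x) _ _ mD (measurableC mD) (setICr D).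
  rewrite setUCr /= !scalar_measureE spmT -EFinD => -[->].
  by rewrite addrC.
suff : rdot (x - y) (x - y) = 0.
  by move=> /rdot_eq0/eqP; rewrite subr_eq0 => xy; apply/eqP; rewrite eq_sym subr_eq.
rewrite /y !rdotBl !rdotBr !rdotDl !rdotDr.
rewrite -!spm_rdot (rdotC (E D x) (E _ x)) cross.
rewrite (rdotC x (E D x)) (rdotC x (E (~` D) x)) -tot.
by ring.
Qed.

Lemma spm_full D x : measurable D -> E (~` D) x = 0 -> E D x = x.
Proof.
move=> mD; rewrite spm_setC// => /eqP.
by rewrite subr_eq0 => /eqP/esym.
Qed.

Lemma integrable_cst_spm D x (c : R) : measurable D ->
  (scalar_measure E x).-integrable D (EFin \o cst c).
Proof.
move=> mD; apply: measurable_bounded_integrable => //.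
- exact: ltry.
- by exists `|c|; split; rewrite ?num_real// => r cr t _ /=; exact: ltW.
Qed.

Lemma Rintegral_cst_spm D x (c : R) : measurable D ->
  \int[scalar_measure E x]_(t in D) c = c * rdot (E D x) x.
Proof. by move=> mD; rewrite Rintegral_cst. Qed.

Lemma Rintegral_spm_full S x (f : T -> R) : measurable S -> E S x = x ->
  (scalar_measure E x).-integrable setT (EFin \o f) ->
  \int[scalar_measure E x]_(t in S) f t = \int[scalar_measure E x]_t f t.
Proof.
move=> mS Sx fi; rewrite /Rintegral; congr fine; apply/esym.
rewrite (negligible_integral (measurableC mS) _ fi) ?setTD ?setCK//.
by apply: spm_nullE; rewrite spm_setC// Sx subrr.
Qed.

Section step_functions.
Context (K : finType) (C : K -> set T) (S : set T) (x : H) (f : T -> R).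
Hypotheses (mC : forall k, measurable (C k))
  (trivC : forall k l t, C k t -> C l t -> k = l)
  (mS : measurable S) (Sx : E S x = x) (SC : forall t, S t -> exists k, C k t)
  (fi : (scalar_measure E x).-integrable S (EFin \o f)).

(** The integral of [f] is compared with that of the simple function equal to
[c k] on [C k]; the cells need only cover a set [S] of full measure. *)
Lemma Rintegral_le_step (c : K -> R) :
  (forall k t, C k t -> S t -> f t <= c k) ->
  \int[scalar_measure E x]_(t in S) f t <= \sum_k c k * rdot (E (C k) x) x.
Proof.
move=> fc; pose F k := C k `&` S.
have mF k : measurable (F k) by exact: measurableI.
have SE : \big[setU/set0]_(k <- index_enum K) F k = S.
  rewrite -bigcup_seq; apply/seteqP; split => [t [k _ []]//|t St].
  by have [k Ck] := SC St; exists k => //=; rewrite mem_index_enum.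
have mf : measurable_fun S (EFin \o f) by exact: measurable_int fi.
rewrite -lee_fin /Rintegral fineK; last exact: integrable_fin_num.
rewrite -[in leLHS]SE integral_bigsetU_EFin//=; last 3 first.
- exact: index_enum_uniq.
- by apply/trivIsetP => k l _ _ /eqP kl; rewrite -subset0 => t [[Ck _] [Cl _]];
    apply: kl; exact: trivC Ck Cl.
- by rewrite SE.
rewrite -sumEFin; apply: lee_sum => k _.
have -> : (c k * rdot (E (C k) x) x)%:E =
    (\int[scalar_measure E x]_(t in F k) cst (c k)%:E t)%E.
  rewrite integral_cst// EFinM -[X in (_ = _ * X)%E]/((rdot (E (F k) x) x)%:E).
  by rewrite spmI// Sx.
apply: le_integral => //.
- by apply: integrableS fi => //; exact: subIsetr.
- exact: integrable_cst_spm.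
- by move=> t; rewrite inE => -[Ck St]; rewrite lee_fin; exact: fc.
Qed.

End step_functions.

Lemma Rintegral_ge_step (K : finType) (C : K -> set T) (S : set T) (x : H)
    (f : T -> R) (c : K -> R) :
  (forall k, measurable (C k)) -> (forall k l t, C k t -> C l t -> k = l) ->
  measurable S -> E S x = x -> (forall t, S t -> exists k, C k t) ->
  (scalar_measure E x).-integrable S (EFin \o f) ->
  (forall k t, C k t -> S t -> c k <= f t) ->
  \sum_k c k * rdot (E (C k) x) x <= \int[scalar_measure E x]_(t in S) f t.
Proof.
move=> mC trivC mS Sx SC fi cf.
have nfi : (scalar_measure E x).-integrable S (EFin \o (fun t => -1 * f t)).
  rewrite (_ : _ \o _ = (fun t => (-1)%:E * (EFin \o f) t)%E).
    exact: integrableZl.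
  by apply/funext => t /=.
have nfc k t : C k t -> S t -> -1 * f t <= - c k.
  by move=> Ck St; rewrite mulN1r lerN2; exact: cf.
have := Rintegral_le_step mC trivC mS Sx SC nfi nfc.
rewrite RintegralZl// mulN1r.
rewrite (eq_bigr (fun k => - (c k * rdot (E (C k) x) x))); last first.
  by move=> k _; rewrite mulNr.
by rewrite sumrN lerN2.
Qed.

(** Both step comparisons applied to the constant 1 show that the masses of the
cells add up to [<x, x>], which is what makes the projections sum to the
identity. *)
Lemma resolution_spm (K : finType) (C : K -> set T) (S : set T) :
  (forall k, measurable (C k)) -> (forall k l t, C k t -> C l t -> k = l) ->
  measurable S -> (forall x, E S x = x) -> (forall t, S t -> exists k, C k t) ->
  resolution (fun k => E (C k)).
Proof.
move=> mC trivC mS Sx SC.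
have orth k l x : E (C k) (E (C l) x) = if k == l then E (C k) x else 0.
  rewrite -spmI//; case: eqVneq => [->|kl]; first by rewrite setIid.
  rewrite (_ : _ `&` _ = set0) ?spm0// -subset0 => t [Ck Cl].
  by move/eqP : kl; apply; exact: trivC Ck Cl.
split=> // [k x y|x]; first exact: spm_sa.
pose y := \sum_k E (C k) x.
have oneE : \sum_k rdot (E (C k) x) x = rdot x x.
  have int1 : \int[scalar_measure E x]_(t in S) cst 1 t = rdot x x.
    by rewrite Rintegral_cst_spm// mul1r Sx.
  rewrite -int1; apply/le_anti/andP; split.
    have := @Rintegral_ge_step _ _ _ x (cst 1) (fun=> 1) mC trivC mS (Sx x) SC
      (integrable_cst_spm _ _ mS).
    by under eq_bigr do rewrite mul1r; apply.
  have := @Rintegral_le_step _ _ _ x (cst 1) mC trivC mS (Sx x) SC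
    (integrable_cst_spm _ _ mS) (fun=> 1).
  by under eq_bigr do rewrite mul1r; apply.
have yx : rdot y x = rdot x x by rewrite rdot_suml.
have yy : rdot y y = rdot x x.
  rewrite rdot_suml -oneE; apply: eq_bigr => k _.
  rewrite spm_sa linear_sum (bigD1 k)//= orth eqxx big1 ?addr0 1?rdotC//.
  by move=> l lk; rewrite orth eq_sym (negPf lk).
apply/eqP; rewrite -subr_eq0; apply/eqP/rdot_eq0.
by rewrite rdotBl !rdotBr (rdotC x y) yx yy !subrr.
Qed.

End spectral_measure_theory.

(** * Support and marginals of a joint spectral measure *)

Section support.
Context (R : realType) (n : nat) (H : hilbertSpace R)
  (E : spectral_measure H (borel_rV R n)).

Lemma closed_spm_support : closed (spm_support E).
Proof.
rewrite -[spm_support E]setCK; apply: open_closedC; rewrite openE => s.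
move=> /existsNP[V /not_implyP[oV /not_implyP[Vs /forallNP EV]]].
apply: (@filterS _ _ _ V); last exact: open_nbhs_nbhs.
move=> t Vt /(_ V oV Vt)[x]; exact: EV.
Qed.

Lemma measurable_spm_support :
  measurable (spm_support E : set (borel_rV R n)).
Proof.
rewrite -[X in measurable X]setCK; apply: measurableC.
by apply: open_borel_rV; exact: closed_openC closed_spm_support.
Qed.

(** A countable base of the topology, up to inclusion: it replaces a Lindeloef
property in the proof that the complement of the support is a null set. *)
Let rat_box (p : 'rV[rat]_n * nat) : set (borel_rV R n) :=
  [set s : 'rV[R]_n | forall i,
    ball (ratr (p.1 ord0 i) : R) p.2.+1%:R^-1 (s ord0 i)].

Let measurable_rat_box p : measurable (rat_box p).
Proof.
apply: (@measurable_forall_coord _ _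
  (fun i => ball (ratr (p.1 ord0 i) : R) p.2.+1%:R^-1)) => i.
exact: measurable_ball.
Qed.

Let rat_box_nbhs (V : set 'rV[R]_n) s : open V -> V s ->
  exists p, rat_box p s /\ (rat_box p : set 'rV[R]_n) `<=` V.
Proof.
move=> oV Vs; have /nbhs_ballP[e /= e0 seV] : nbhs s V.
  exact: open_nbhs_nbhs.
have e20 : 0 < e / 2 by rewrite divr_gt0.
have [m _ /(_ m (leqnn m)) me] := near_infty_natSinv_lt (PosNum e20).
have sm i : s ord0 i - m.+1%:R^-1 < s ord0 i + m.+1%:R^-1.
  by rewrite ltrBlDr -addrA ltrDl addr_gt0// invr_gt0.
pose q := \row_i sval (cid (rat_in_itvoo (sm i))).
have qE i : `|ratr (q ord0 i) - s ord0 i| < m.+1%:R^-1.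
  rewrite mxE; case: cid => r /=; rewrite in_itv/= => /andP[lo hi].
  by rewrite ltr_distl lo hi.
exists (q, m); split=> [i|t qt].
  exact: qE.
apply: seV; split=> // i' i; rewrite ord1 {i'}.
have := qt i; have := qE i; rewrite /ball /= => h1 h2.
rewrite -[X in `|X|](subrKA (ratr (q ord0 i))).
apply: le_lt_trans (ler_normD _ _) _; rewrite distrC.
by have := ltrD (lt_trans h1 me) (lt_trans h2 me); rewrite -splitr.
Qed.

(** Every point outside the support lies in a null rational box, and there are
countably many of them. *)
Lemma spm_setC_support x : E (~` spm_support E) x = 0.
Proof.
pose null p := `[< forall y, E (rat_box p) y = 0 >].
pose F i := if unpickle i is Some p then
  (if null p then rat_box p else set0) else set0.
have mF i : measurable (F i).
  by rewrite /F; case: unpickle => // p; case: ifP.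
apply: spm_null; apply: measure_negligible.
  by apply: measurableC; exact: measurable_spm_support.
apply: (@negligibleS _ _ _ _ (\bigcup_i F i)); last first.
  apply: negligible_bigcup => i; apply/negligibleP => //.
  rewrite /F; case: unpickle => [p|]; last exact: measure0.
  case: ifPn => [/asboolP nullp|_]; last exact: measure0.
  exact: spm_nullE.
move=> s /existsNP[V /not_implyP[oV /not_implyP[Vs /forallNP EV]]].
have [p [ps pV]] := rat_box_nbhs oV Vs.
exists (pickle p) => //; rewrite /F pickleK ifT//; apply/asboolP => y.
rewrite -(setIidl pV) spmI//; last exact: open_borel_rV.
have -> : E V y = 0 by apply/eqP/negPn/negP; exact: EV.
exact: linear0.
Qed.

Lemma spm_support_full x : E (spm_support E) x = x.
Proof.
by apply: spm_full; [exact: measurable_spm_support|exact: spm_setC_support].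
Qed.

End support.

Section marginals.
Context (R : realType) (n : nat) (H : hilbertSpace R).

(** The case of interest is a box all of whose sides but one are the whole line,
where the spectral product collapses to a single projection. *)
Lemma big_comp_single (X : Type) (I : eqType) (r : seq I) (j : I)
    (F : I -> X -> X) (x : X) :
  uniq r -> (forall i y, i != j -> F i y = y) ->
  (\big[comp/idfun]_(i <- r) F i) x = if j \in r then F j x else x.
Proof.
move=> + Fid; elim: r => [|i r IH] /=; first by rewrite big_nil.
rewrite big_cons inE /= => /andP[ir /IH ->].
have [ij|ij] := eqVneq j i; last by rewrite Fid// eq_sym.
by rewrite ij (negPf ir).
Qed.

Context (A : 'I_n -> {linear H -> H}) (E : spectral_measure H (borel_rV R n)).
Hypothesis AE : is_joint_spectral_measure A E.

(** The spectral measure of [A j] is the image of [E] by the [j]-th coordinate. *)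
Lemma joint_coord_integral j x :
  (scalar_measure E x).-integrable setT
    (EFin \o (fun s : borel_rV R n => (s : 'rV[R]_n) ord0 j)) /\
  rdot (A j x) x =
    \int[scalar_measure E x]_(s in setT) (s : 'rV[R]_n) ord0 j.
Proof.
have [Ej [AEj EEj]] := AE.
have [ti Ax] := AEj j x.
pose phi (s : borel_rV R n) : measurableTypeR R := (s : 'rV[R]_n) ord0 j.
have mphi : measurable_fun setT phi by exact: measurable_coord.
have marg D : measurable D ->
    scalar_measure (Ej j) x D = pushforward (scalar_measure E x) phi D.
  move=> mD; rewrite /pushforward.
  have -> : phi @^-1` D = [set s : 'rV[R]_n | forall i,
      (if i == j then D else setT) (s ord0 i)].
    apply/seteqP; split => [s Ds i|s /(_ j)]; last by rewrite eqxx.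
    by case: eqVneq => // ->.
  rewrite !scalar_measureE (EEj (fun i => if i == j then D else setT));
    last by move=> i; case: ifP.
  rewrite (big_comp_single _ (j := j)) ?index_enum_uniq//; last first.
    by move=> i y /negPf ->; rewrite spmT.
  by rewrite mem_index_enum eqxx.
have si : (scalar_measure E x).-integrable setT (EFin \o phi).
  apply/integrableP; split; first exact: measurableT_comp.
  have [_] := integrableP _ _ _ ti.
  have mabs : measurable_fun [set: measurableTypeR R]
      (fun y : measurableTypeR R => `|y%:E|%E).
    by apply: measurableT_comp; [exact: abse_measurable|exact: EFin_measurable].
  rewrite (eq_measure_integral (pushforward (scalar_measure E x) phi)); last first.
    by move=> D mD _; exact: marg.
  by rewrite ge0_integral_pushforward.
split=> //.
have -> : rdot (A j x) x = \int[scalar_measure (Ej j) x]_t idfun t.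
  by rewrite /rdot Ax.
rewrite /Rintegral; congr fine.
rewrite (eq_measure_integral (pushforward (scalar_measure E x) phi)); last first.
  by move=> D mD _; exact: marg.
rewrite integral_pushforward//.
exact: EFin_measurable.
Qed.

End marginals.

(** * Compactness of the joint spectrum *)

Section topology_rV.
Context (R : realType) (n : nat).

Lemma open_positive_orthant : open (positive_orthant R n).
Proof.
rewrite openE => s s0.
have near_i i : nbhs s [set t : 'rV[R]_n | 0 < t ord0 i].
  by apply: open_nbhs_nbhs; split; [exact: open_coord_gt|exact: s0].
exact: (filter_forall _ near_i).
Qed.

(** Uniform continuity of [f] near [K], with [t] allowed to leave [K]: the corners
of a grid cell that meets [K] need not belong to [K], and must be known to stay
in [U]. *)
Lemma compact_uniform_nbhs (K U : set 'rV[R]_n) (f : 'rV[R]_n -> R) (e : R) :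
  compact K -> open U -> K `<=` U -> {within U, continuous f} -> 0 < e ->
  exists2 h : R, 0 < h & forall s t : 'rV[R]_n, K s ->
    (forall j, `|s ord0 j - t ord0 j| < h) -> U t /\ `|f s - f t| < e.
Proof.
move=> cK oU KU; rewrite continuous_open_subspace// => fc e0.
have e20 : 0 < e / 2 by rewrite divr_gt0.
pose good (h : R) (s : 'rV[R]_n) := forall t : 'rV[R]_n,
  (forall j, `|s ord0 j - t ord0 j| < h) -> U t /\ `|f s - f t| < e.
have : \forall h \near (0 : R)^'+, K `<=` good h.
  apply: (compact_near_coveringP _).1 => // s Ks.
  have Us := KU s Ks.
  have /nbhs_ballP[r /= r0 sr] :
      \forall t \near s, U t /\ `|f s - f t| < e / 2.
    apply: filterI; first exact: open_nbhs_nbhs.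
    by have /cvgrPdist_lt := fc s (mem_set Us); apply.
  have r20 : 0 < r / 2 by rewrite divr_gt0.
  exists (ball s (r / 2), [set h | h < r / 2]) => /=.
    by split; [exact: nbhsx_ballx|exact: nbhs_right_lt].
  move=> [s' h] /= [ss' hr] t s't.
  have st : ball s r t.
    split=> // i j; rewrite ord1 {i}; have [_ /(_ ord0 j)] := ss'.
    rewrite /ball /= => h1; have h2 := lt_trans (s't j) hr.
    rewrite -[X in `|X|](subrKA (s' ord0 j)).
    apply: le_lt_trans (ler_normD _ _) _.
    by have := ltrD h1 h2; rewrite -splitr.
  have ss'r : ball s r s'.
    by apply: le_ball ss'; lra.
  have [Ut ft] := sr _ st; have [_ fs'] := sr _ ss'r.
  split=> //; rewrite -[X in `|X|](subrKA (f s)).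
  apply: le_lt_trans (ler_normD _ _) _; rewrite distrC.
  by have := ltrD fs' ft; rewrite -splitr.
move=> near_good.
near (0 : R)^'+ => h.
exists h => // s t Ks; apply: (near near_good h) => //.
Unshelve. all: by end_near. Qed.

End topology_rV.

Section spectral_bounds.
Context (R : realType) (n : nat) (H : hilbertSpace R).

(** The bound in [bounded_op] is a complex number; its real part bounds the norm
as well, because both sides of the inequality are compared through their real
parts. *)
Lemma bounded_op_form (S : H -> H) : bounded_op S ->
  exists2 M : R, 0 <= M & forall x, rdot (S x) x <= M * rdot x x.
Proof.
move=> [M SM]; exists `|complex.Re M| => // x.
have rnormE (y : H) : `|y| = (complex.Re `|y|)%:C.
  by rewrite RRe_real.
have rnorm_ge0 (y : H) : 0 <= complex.Re `|y|.
  by rewrite -ler0c -rnormE normr_ge0.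
have rdotE (y : H) : rdot y y = complex.Re `|y| ^+ 2.
  have := hdot_norm y; rewrite hdotxx {1}rnormE -rmorphXn/=.
  by move/complexI.
have SxM : complex.Re `|S x| <= `|complex.Re M| * complex.Re `|x|.
  have ReM (w : R[i]) (a : R) : complex.Re (w * a%:C) = complex.Re w * a.
    by case: w => u v /=; rewrite mulr0 subr0.
  have h := SM x; rewrite (rnormE x) lecE ReM in h.
  move: h => /andP[_] /le_trans; apply.
  by rewrite ler_wpM2r// ler_norm.
have := rdot_cauchy_schwarz (S x) x; rewrite !rdotE => cs.
have {}cs : rdot (S x) x ^+ 2 <= (`|complex.Re M| * complex.Re `|x| ^+ 2) ^+ 2.
  apply: le_trans cs _.
  rewrite [leRHS](_ : _ = (`|complex.Re M| * complex.Re `|x|) ^+ 2 *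
    complex.Re `|x| ^+ 2); last by ring.
  by rewrite ler_wpM2r ?sqr_ge0// ler_sqr ?nnegrE ?mulr_ge0.
apply: le_trans (ler_norm _) _.
by rewrite -ler_sqr ?nnegrE ?mulr_ge0 ?sqr_ge0// real_normK ?num_real.
Qed.

Context (A : 'I_n -> {linear H -> H}) (E : spectral_measure H (borel_rV R n)).
Hypothesis AE : is_joint_spectral_measure A E.

(** On the range of [E(D)], with [D] the half-space where the [j]-th coordinate
exceeds [M + 1], the form of [A j] is at least [(M + 1) |y|^2], and at most
[M |y|^2] if [M] bounds [A j]; so this range is zero. *)
Lemma spm_support_le (j : 'I_n) : bounded_op (A j) ->
  exists M : R, forall s, spm_support E s -> s ord0 j <= M.
Proof.
move=> /bounded_op_form[M M0 AM]; exists (M + 1) => s Es.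
rewrite leNgt; apply/negP => Ms.
pose D : set (borel_rV R n) := [set t : 'rV[R]_n | M + 1 < t ord0 j].
have oD : open (D : set 'rV[R]_n) by exact: open_coord_gt.
have mD : measurable D by exact: open_borel_rV.
have [x /eqP] := Es D oD Ms; apply.
pose y := E D x; rewrite -/y.
have Dy : E D y = y by exact: spm_idem.
have [ji Ay] := joint_coord_integral AE j y.
have := @Rintegral_ge_step _ _ _ _ E 'I_1 (fun=> D) D y
  (fun t : borel_rV R n => (t : 'rV[R]_n) ord0 j) (fun=> M + 1)
  (fun=> mD) (fun k l _ _ _ => etrans (ord1 k) (esym (ord1 l))) mD Dy
  (fun t Dt => ex_intro _ ord0 Dt) (integrableS measurableT mD (@subsetT _ D) ji)
  (fun _ t Dt _ => ltW Dt).
rewrite big_ord1 Dy (Rintegral_spm_full mD Dy ji) -Ay => h.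
have := le_trans h (AM y); rewrite mulrDl mul1r gerDl => yy.
by apply: rdot_eq0; apply/le_anti; rewrite yy rdot_ge0.
Qed.

Lemma compact_spm_support : (forall j, bounded_op (A j)) ->
  spm_support E `<=` positive_orthant R n ->
  compact (spm_support E) /\
  exists M : R, forall s, spm_support E s -> forall j, s ord0 j <= M.
Proof.
move=> Abnd EU.
have /choice[M EM] j : exists M : R, forall s, spm_support E s -> s ord0 j <= M.
  exact: spm_support_le.
split; last first.
  exists (\sum_j `|M j|) => s Es j; apply: le_trans (EM j s Es) _.
  apply: le_trans (ler_norm _) _; rewrite (bigD1 j)//= lerDl.
  by apply: sumr_ge0.
apply: (@subclosed_compact _ _
    [set s : 'rV[R]_n | forall j, `[0, M j]%classic (s ord0 j)]).
- exact: closed_spm_support.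
- apply: (@rV_compact _ _ (fun j => `[0, M j]%classic)) => j.
  exact: segment_compact.
- by move=> s Es j; rewrite /= in_itv/= EM// ltW//; exact: EU.
Qed.

End spectral_bounds.

(** * Approximation by tuples with finite spectrum *)

Section discretization.
Context (R : realType) (n : nat) (H : hilbertSpace R).

(** [P] consists of the spectral projections of the cells of a grid, [a] and [b]
of their lower and upper corners. *)
Lemma discretization (A : 'I_n -> {linear H -> H})
    (E : spectral_measure H (borel_rV R n)) (f : 'rV[R]_n -> R) (e : R) :
  is_joint_spectral_measure A E -> (forall j, bounded_op (A j)) ->
  spm_support E `<=` positive_orthant R n ->
  {within positive_orthant R n, continuous f} -> 0 < e ->
  exists (K : finType) (P : K -> {linear H -> H}) (a b : K -> 'rV[R]_n),
    [/\ resolution P,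
        forall k, positive_orthant R n (a k) /\ positive_orthant R n (b k),
        forall j x, diag_form P (fun k => a k ord0 j) x <= rdot (A j x) x,
        forall j x, rdot (A j x) x <= diag_form P (fun k => b k ord0 j) x &
        forall x,
          (scalar_measure E x).-integrable (spm_support E) (EFin \o f) ->
          \int[scalar_measure E x]_(s in spm_support E) f s <=
            diag_form P (f \o a) x + e * rdot x x /\
          diag_form P (f \o b) x <=
            \int[scalar_measure E x]_(s in spm_support E) f s + e * rdot x x].
Proof.
move=> AE Abnd EU fc e0.
have [cS [M SM]] := compact_spm_support AE Abnd EU.
have [h0 h0_gt0 Hh0] := compact_uniform_nbhs cS (@open_positive_orthant R n) EU fc e0.
pose S := spm_support E.
have mS : measurable (S : set (borel_rV R n)) by exact: measurable_spm_support.
have Sx x : E S x = x by exact: spm_support_full.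
pose h := h0 / 2.
have h_gt0 : 0 < h by rewrite divr_gt0.
have hh0 : h < h0 by rewrite /h; lra.
pose N := (Num.truncn (M / h)).+1.
pose K : finType := {ffun 'I_n -> 'I_N}.
pose C (k : K) : set (borel_rV R n) := [set s : 'rV[R]_n | forall j,
  `[(k j)%:R * h, (k j).+1%:R * h[%classic (s ord0 j)].
have CE k (s : 'rV[R]_n) j : C k s ->
    (k j)%:R * h <= s ord0 j /\ s ord0 j < (k j).+1%:R * h.
  by move=> /(_ j); rewrite /= in_itv/= => /andP[].
have mC k : measurable (C k).
  exact: (@measurable_forall_coord _ _
    (fun j => `[(k j)%:R * h, (k j).+1%:R * h[%classic)).
have trivC k l t : C k t -> C l t -> k = l.
  have index m : C m t -> forall j, Num.truncn ((t : 'rV[R]_n) ord0 j / h) = m j.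
    move=> Cm j; apply: truncn_def; have [lo hi] := CE m t j Cm.
    by rewrite ler_pdivlMr// lo ltr_pdivrMr.
  by move=> Ck Cl; apply/ffunP => j; apply/val_inj; rewrite /= -!index.
have SC s : S s -> exists k, C k s.
  move=> Ss; exists [ffun j => inord (Num.truncn (s ord0 j / h))] => j.
  have sj0 : 0 <= s ord0 j / h by rewrite divr_ge0 ?ltW//; exact: EU.
  rewrite /= in_itv/= ffunE inordK; last first.
    by rewrite ltnS le_truncn// ler_pM2r ?invr_gt0//; exact: SM.
  have /andP[lo hi] := truncn_itv sj0.
  by rewrite -ler_pdivlMr// lo -ltr_pdivrMr.
(* A cell that misses the support carries a null projection, but its corners may
lie on the boundary of the orthant, hence the value 1 there. *)
pose touch k := `[< exists2 s, S s & C k s >].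
pose a k : 'rV[R]_n :=
  if touch k then \row_j ((k j)%:R * h) else const_mx 1.
pose b k : 'rV[R]_n :=
  if touch k then \row_j ((k j).+1%:R * h) else const_mx 1.
have one_gt0 : positive_orthant R n (const_mx 1).
  by move=> i; rewrite mxE.
have aE k s j : C k s -> S s -> a k ord0 j = (k j)%:R * h.
  by move=> Ck Ss; rewrite /a ifT ?mxE//; apply/asboolP; exists s.
have bE k s j : C k s -> S s -> b k ord0 j = (k j).+1%:R * h.
  by move=> Ck Ss; rewrite /b ifT ?mxE//; apply/asboolP; exists s.
have a_near k s : C k s -> S s ->
    positive_orthant R n (a k) /\ `|f s - f (a k)| < e.
  move=> Ck Ss; apply: Hh0 => // j; rewrite (aE k s j)//.
  have [lo hi] := CE k s j Ck; rewrite ltr_norml.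
  move: hi; rewrite -natr1 mulrDl mul1r => hi; lra.
have b_near k s : C k s -> S s ->
    positive_orthant R n (b k) /\ `|f s - f (b k)| < e.
  move=> Ck Ss; apply: Hh0 => // j; rewrite (bE k s j)//.
  have [lo hi] := CE k s j Ck; rewrite ltr_norml.
  move: hi; rewrite -natr1 mulrDl mul1r => hi; lra.
pose P k : {linear H -> H} := E (C k).
have resP : resolution P by exact: (resolution_spm mC trivC mS Sx SC).
have coordi j x := joint_coord_integral AE j x.
have coordS j x : (scalar_measure E x).-integrable S
    (EFin \o (fun s : borel_rV R n => (s : 'rV[R]_n) ord0 j)).
  exact: integrableS (coordi j x).1.
exists K, P, a, b; split=> //.
- move=> k; have [/asboolP[s Ss Ck]|nk] := boolP (touch k).
    by split; [exact: (a_near k s Ck Ss).1|exact: (b_near k s Ck Ss).1].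
  by rewrite /a /b (negPf nk).
- move=> j x; rewrite (coordi j x).2 -(Rintegral_spm_full mS (Sx x) (coordi j x).1).
  apply: (Rintegral_ge_step mC trivC mS (Sx x) SC (coordS j x)) => k s Ck Ss.
  by rewrite (aE k s j)//; exact: (CE k s j Ck).1.
- move=> j x; rewrite (coordi j x).2 -(Rintegral_spm_full mS (Sx x) (coordi j x).1).
  apply: (Rintegral_le_step mC trivC mS (Sx x) SC (coordS j x)) => k s Ck Ss.
  by rewrite (bE k s j)// ltW//; exact: (CE k s j Ck).2.
move=> x fi.
have shift (c : K -> R) (r : R) :
    \sum_k (c k + r) * rdot (E (C k) x) x = diag_form P c x + r * rdot x x.
  rewrite -(sum_proj_rdot resP x) mulr_sumr -big_split/=.
  by apply: eq_bigr => k _; rewrite mulrDl.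
split.
  rewrite -shift.
  apply: (Rintegral_le_step mC trivC mS (Sx x) SC fi) => k s Ck Ss.
  have [_] := a_near k s Ck Ss; rewrite ltr_norml => /andP[_].
  by rewrite ltrBlDl => /ltW.
rewrite -lerBlDr -mulNr -shift.
apply: (Rintegral_ge_step mC trivC mS (Sx x) SC fi) => k s Ck Ss.
have [_] := b_near k s Ck Ss; rewrite ltr_norml => /andP[lo _].
by rewrite lerBlDr -lerBlDl /=; lra.
Qed.

End discretization.

Theorem theorem2 (R : realType) (n : nat) (alpha : R) (f : 'rV[R]_n -> R)
    (hn : (1 <= n)%N) (halpha : 0 <= alpha <= n%:R^-1)
    (hf : class_Q alpha (positive_orthant R n) f) :
  operator_monotone (positive_orthant R n) f.
Proof.
have /andP[alpha_ge0 alpha_le] := halpha.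
have nalpha : n%:R * alpha <= 1.
  by rewrite mulrC -ler_pdivlMr ?ltr0n// div1r.
have [fc _ _] := hf; split=> // H A B [Asa _] [Bsa _] specU leAB fA fB.
move=> [EA [AE fAE]] [EB [BE fBE]] x.
have EAU : spm_support EA `<=` positive_orthant R n.
  by move=> s Es; apply: specU; left; exists EA.
have EBU : spm_support EB `<=` positive_orthant R n.
  by move=> s Es; apply: specU; right; exists EB.
rewrite linearBl /= (fAE x).2 (fBE x).2 subr_ge0 lecR.
apply/ler_addgt0Pr => e e_gt0.
(* Each of the two discretizations costs [r |x|^2 <= e / 2]. *)
pose r := e / ((rdot x x + 1) *+ 2).
have den_gt0 : 0 < (rdot x x + 1) *+ 2.
  by rewrite pmulrn_rgt0// ltr_wpDl// rdot_ge0.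
have r_gt0 : 0 < r by rewrite divr_gt0.
have [K [P [a [b [resP ab_gt0 aA _ faf]]]]] :=
  discretization AE (fun j => (Asa j).1) EAU fc r_gt0.
have [L [Q [c [d [resQ cd_gt0 _ Bd fdf]]]]] :=
  discretization BE (fun j => (Bsa j).1) EBU fc r_gt0.
have le_ad j : form_le P Q (fun k => a k ord0 j) (fun l => d l ord0 j).
  move=> y; apply: le_trans (aA j y) _; apply: le_trans (Bd j y).
  have := leAB j y; rewrite lecE => /andP[_].
  by rewrite linearBl raddfB/= subr_ge0.
have fad := class_Q_form_le alpha_ge0 nalpha resP resQ
  (fun k => (ab_gt0 k).1) (fun l => (cd_gt0 l).2) le_ad hf x.
have [hA _] := faf x (fAE x).1.
have [_ hB] := fdf x (fBE x).1.
have re : r * rdot x x *+ 2 <= e.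
  rewrite /r -mulrnAr mulrAC ler_pdivrMr// ler_pM2l//.
  by rewrite lerMn2r lerDl ler01 orbT.
move: re; rewrite mulr2n; lra.
Qed.
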